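(* For each $n$ and each integer $m$ with $n\le m\le\binom n2$, there exists a sequence of $m$ edge insertions on a directed acyclic graph with $n$ vertices for which the algorithm FDFS requires $\Theta(mn)$ time to maintain the DFS tree.
   Context: Incremental DFS problem for DAGs: directed edges are inserted online into a directed graph on $n$ vertices, initially empty, keeping it acyclic; after each insertion a DFS tree of the current graph must be available. The graph is augmented with a pseudo root $s$ having an edge to every vertex, and the tree is rooted at $s$. Children of each vertex are ordered left to right. A non-tree edge is an anti-cross edge if it is directed from left to right between two vertices not in ancestor–descendant relation; an ordered rooted spanning tree is a DFS tree iff there are no anti-cross edges. The constants in $\Theta$ are absolute. Algorithm FDFS: it maintains the DFS tree $T$ and the post-order number $\mathrm{DFN}[v]$ of each vertex in $T$. On insertion of an edge $(x,y)$: if $\mathrm{DFN}[x]\ge\mathrm{DFN}[y]$, it is not an anti-cross edge, and FDFS only adds the edge to the graph. Otherwise FDFS performs a partial DFS from $y$ in the subgraph induced by the vertices $z$ with $\mathrm{DFN}[x]<\mathrm{DFN}[z]\le\mathrm{DFN}[y]$, processing all outgoing edges of the visited vertices; it removes the vertices reached from their current positions in $T$, and hangs the newly computed DFS tree rooted at $y$ from $x$ through the edge $(x,y)$ (as a new rightmost child of $x$), then updates the DFN numbers of all vertices in this range. The running time is dominated by the number of edges processed, plus the number of vertices whose DFN number is updated. *)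

(* Defs.v *)
From mathcomp Require Import all_boot.
Set Implicit Arguments.
Unset Strict Implicit.
Unset Printing Implicit Defensive.

Inductive otree (V : Type) : Type := Node of V & seq (otree V).

Section OrderedTrees.
Variable V : eqType.
Implicit Types (t : otree V) (ts : seq (otree V)) (R : seq V).

Definition troot t : V := let: Node v _ := t in v.

Fixpoint postorder t : seq V :=
  let: Node v ts := t in rcons (flatten (map postorder ts)) v.

(* Numbered from 0; only comparisons and differences of numbers matter. *)
Definition DFN t (v : V) : nat := index v (postorder t).

(* Whole subtrees are dropped: the descendants in the DFS tree of a vertex
   reached by a partial DFS are themselves reached, because the graph is
   acyclic. *)
Fixpoint prune R t : otree V :=
  let: Node v ts := t in
  Node v (pmap (fun u => if troot u \in R then None else Some (prune R u)) ts).

Fixpoint graft (x : V) (new : seq (otree V)) t : otree V :=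
  let: Node v ts := t in
  let ts' := map (graft x new) ts in
  Node v (if v == x then ts' ++ new else ts').

End OrderedTrees.

(* A graph is the list of its edges in order of insertion. *)
Definition acyclic (V : eqType) (E : seq (V * V)) : Prop :=
  forall p : seq V, cycle [rel u v | (u, v) \in E] p -> p = [::].

(* FDFS does not specify in which order the out-neighbours of a vertex are
   scanned: [ord E v] is that order in the graph E. It may depend on the
   whole insertion history. *)
Definition adjacency_order (V : eqType) (ord : seq (V * V) -> V -> seq V) :
    Prop :=
  forall E v, perm_eq (ord E v) [seq e.2 | e <- E & e.1 == v].

Section FDFS.
Variable V : finType.

(* Search from v among the vertices satisfying [cand]. The state
   is the list of visited vertices and the DFS forest built so far at the
   current level. The recursion depth k = #|V| is never exhausted. *)
Fixpoint partial_dfs (adj : V -> seq V) (cand : pred V) (k : nat)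
    (st : seq V * seq (otree V)) (v : V) : seq V * seq (otree V) :=
  if (v \in st.1) || ~~ cand v then st
  else if k is k'.+1 then
    let st' := foldl (partial_dfs adj cand k') (v :: st.1, [::]) (adj v) in
    (st'.1, rcons st.2 (Node v st'.2))
  else st.

Variable ord : seq (V * V) -> V -> seq V.

(* Insertion of e into the graph E with DFS tree T: the new tree and the cost.
   The cost counts every outgoing edge of every visited vertex, also those
   leaving the candidate range, and the vertices that are renumbered: those of
   the range and x, which moves after the vertices hung below it. *)
Definition fdfs_insert (E : seq (V * V)) (T : otree V) (e : V * V) :
    otree V * nat :=
  let: (x, y) := e in
  if DFN T y <= DFN T x then (T, 0)
  else
    let adj := ord (rcons E e) in
    let cand := [pred z | DFN T x < DFN T z <= DFN T y] in
    let: (visited, new) := partial_dfs adj cand #|V| ([::], [::]) y in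
    (graft x new (prune visited T),
     \sum_(v <- visited) size (adj v)
       + #|[pred z | DFN T x <= DFN T z <= DFN T y]|).

Fixpoint fdfs_run (E : seq (V * V)) (T : otree V) (es : seq (V * V)) :
    otree V * nat :=
  if es is e :: es' then
    let: (T', c) := fdfs_insert E T e in
    let: (T'', c') := fdfs_run (rcons E e) T' es' in
    (T'', c + c')
  else (T, 0).

End FDFS.

Section FromEmptyGraph.
Variable n : nat.

(* The vertices of the augmented graph; None is the pseudo root s. *)
Definition avertex : finType := option 'I_n.

Definition root_edges : seq (avertex * avertex) :=
  [seq (None, Some i) | i <- enum 'I_n].

Definition augment (es : seq ('I_n * 'I_n)) : seq (avertex * avertex) :=
  [seq (Some e.1, Some e.2) | e <- es].

Variable ord : seq (avertex * avertex) -> avertex -> seq avertex.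

Definition init_tree : otree avertex :=
  Node None [seq Node v [::] | v <- ord root_edges None].

Definition fdfs (es : seq ('I_n * 'I_n)) : otree avertex * nat :=
  fdfs_run ord root_edges init_tree (augment es).

Definition fdfs_time (es : seq ('I_n * 'I_n)) : nat := (fdfs es).2.

End FromEmptyGraph.

(* Main.v *)
Require Import Defs.
From mathcomp Require Import all_boot all_order all_algebra.
From mathcomp Require Import zify.
Set Implicit Arguments.
Unset Strict Implicit.
Unset Printing Implicit Defensive.

(** Split the leaves of the initial star, from left to right, into B (the n/2
    leftmost) and A, and let a be the rightmost vertex of A. Edges inside A from
    right to left, starting with all those leaving a, are not anti-cross and cost
    nothing. Then insert (b, a) for b in B from right to left: each time a hangs
    below the previous b, to the right of the current one, so the search from a
    visits A again and processes all the edges inside A. As these number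
    min(C(n - n/2, 2), m - n/2), which is of order m, the total is of order mn.
    The missing edges leave B and agree with the final postorder: they are free. *)

(** * Ordered pairs of a list as edges of an acyclic graph *)

Section Pairs.
Variable T : eqType.
Implicit Types (l : seq T) (e : T * T).

(** The order of enumeration matters: the pairs leaving the head come first, so a long enough prefix
    contains all of them. *)
Fixpoint ordered_pairs l : seq (T * T) :=
  if l is x :: l' then [seq (x, y) | y <- l'] ++ ordered_pairs l' else [::].

Lemma mem_ordered_pairs l e :
  e \in ordered_pairs l -> e.1 \in l /\ e.2 \in l.
Proof.
elim: l => //= x l IHl; rewrite mem_cat !inE => /orP[/mapP[y yl ->]|/IHl[-> ->]].
  by rewrite eqxx yl orbT.
by rewrite !orbT.
Qed.

Lemma size_ordered_pairs l : size (ordered_pairs l) = 'C(size l, 2).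
Proof.
by elim: l => //= x l IHl; rewrite size_cat size_map IHl binS bin1 addnC.
Qed.

Lemma uniq_ordered_pairs l : uniq l -> uniq (ordered_pairs l).
Proof.
elim: l => //= x l IHl /andP[xl ul]; rewrite cat_uniq IHl // andbT.
rewrite map_inj_uniq ?ul; last by move=> ? ? [].
apply/hasPn => e /mem_ordered_pairs[e1l _]; apply: contra xl => /mapP[y _ De].
by rewrite De in e1l.
Qed.

(** Applied to [l1 = rev B] and [l2 = a :: A], this splits the full edge set into the edges of the
    three insertion phases. *)
Lemma perm_ordered_pairs_cat l1 l2 :
  perm_eq (ordered_pairs (l1 ++ l2))
    (ordered_pairs l2 ++ [seq (x, y) | x <- l1, y <- l2] ++ ordered_pairs l1).
Proof.
elim: l1 => [|x l1 IHl] /=; first by rewrite cats0.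
rewrite map_cat; apply/permP => p; rewrite !count_cat (permP IHl) !count_cat; lia.
Qed.

Lemma index_ordered_pairs_rev l e : uniq l ->
  e \in ordered_pairs (rev l) -> index e.2 l < index e.1 l.
Proof.
elim/last_ind: l => [|l x IHl]; rewrite // rev_rcons rcons_uniq => /andP[xl ul].
rewrite /= mem_cat => /orP[/mapP[y]|e_l].
  rewrite mem_rev => yl -> /=.
  by rewrite -cats1 !index_cat yl (negPf xl) /= eqxx addn0 index_mem.
have [] := mem_ordered_pairs e_l; rewrite !mem_rev => e1l e2l.
by rewrite -cats1 !index_cat e1l e2l IHl.
Qed.

(** Every edge strictly decreases the index in [l], so a closed path would return to its start with
    a smaller index. *)
Lemma acyclic_ordered_pairs_rev l (E : seq (T * T)) : uniq l ->
  {subset E <= ordered_pairs (rev l)} -> acyclic E.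
Proof.
move=> ul sEl [|x p] //= cyc_p.
have path_p: path [rel u v | index v l < index u l] x (rcons p x).
  by apply: sub_path cyc_p => u v /= /sEl/(index_ordered_pairs_rev ul).
have tr: transitive [rel u v | index v l < index u l].
  by move=> v u w /= vu /ltn_trans; apply.
by have /allP/(_ x) := order_path_min tr path_p; rewrite mem_rcons mem_head /= ltnn => /(_ isT).
Qed.

(** Identifies the candidate range of a search, an interval of DFN numbers, with a block of the
    postorder. *)
Lemma mem_index_infix l1 l2 l3 z : uniq (l1 ++ l2 ++ l3) ->
  (z \in l2) = (size l1 <= index z (l1 ++ l2 ++ l3) < size l1 + size l2).
Proof.
rewrite !index_cat cat_uniq => /and3P[_ dis12 _].
case: ifP => [z1|_].
  rewrite leqNgt index_mem z1 /=; apply: contraNF dis12 => z2.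
  by apply/hasP; exists z; rewrite // mem_cat z2.
rewrite leq_addr ltn_add2l; case: ifP => [|_]; first by rewrite index_mem.
by rewrite ltnNge leq_addr.
Qed.

Lemma index_pivot_uniq z l1 l2 : uniq (l1 ++ z :: l2) ->
  index z (l1 ++ z :: l2) = size l1.
Proof.
rewrite cat_uniq => /and3P[_ /hasPn/(_ z (mem_head _ _)) zl1 _].
exact: index_pivot.
Qed.

(** Turns the cost of a search, a sum of out-degrees, into the number of edges leaving the visited
    set. *)
Lemma sum_count_fst l (E : seq (T * T)) : uniq l ->
  \sum_(v <- l) count (fun e => e.1 == v) E = count (fun e => e.1 \in l) E.
Proof.
elim: l => [|v l IHl] /=; first by rewrite big_nil (@eq_count _ _ pred0) ?count_pred0.
case/andP=> vl /IHl{}IHl; rewrite big_cons IHl -count_predUI.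
rewrite [X in _ + X](@eq_count _ _ pred0) ?count_pred0 ?addn0; last first.
  by move=> e /=; apply: contraNF vl => /andP[/eqP->].
by apply: eq_count => e /=; rewrite inE.
Qed.

End Pairs.

(** * Composition of runs and free insertions *)

Section Run.
Variables (V : finType) (ord : seq (V * V) -> V -> seq V).
Implicit Types (E es : seq (V * V)) (T : otree V) (f us : seq (otree V)).
Implicit Types (l P R A B : seq V) (s a x : V).

Local Notation leaf := (fun v : V => Node v [::]).
Local Notation postorders f := (flatten (map (@postorder V) f)).

Lemma postorders_leaf l : postorders (map leaf l) = l.
Proof. by elim: l => //= v l ->. Qed.

Lemma fdfs_run_cons E T e es (r1 := fdfs_insert ord E T e) :
  fdfs_run ord E T (e :: es) =
  ((fdfs_run ord (rcons E e) r1.1 es).1,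
   r1.2 + (fdfs_run ord (rcons E e) r1.1 es).2).
Proof. by rewrite /= -/r1; case: r1 => T' c; case: fdfs_run. Qed.

Lemma fdfs_run_cat E T es1 es2 (r1 := fdfs_run ord E T es1) :
  fdfs_run ord E T (es1 ++ es2) =
  ((fdfs_run ord (E ++ es1) r1.1 es2).1,
   r1.2 + (fdfs_run ord (E ++ es1) r1.1 es2).2).
Proof.
rewrite {}/r1; elim: es1 E T => [|e es1 IHes] E T; first by rewrite cats0; case: fdfs_run.
by rewrite cat_cons !fdfs_run_cons IHes cat_rcons addnA.
Qed.

(** A free insertion leaves the tree unchanged, so it is enough to compare DFN numbers in the
    initial [T]. *)
Lemma fdfs_run_no_anticross E T es :
  (forall e, e \in es -> DFN T e.2 <= DFN T e.1) ->
  fdfs_run ord E T es = (T, 0).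
Proof.
elim: es E => //= [[x y] es] IHes E Tes.
have /= -> := Tes (x, y) (mem_head _ _); rewrite IHes // => e e_es.
by rewrite Tes // inE e_es orbT.
Qed.

(** * What a partial DFS visits *)

(** Here [l] is newly visited and [f] newly built. The relation is transitive and ignores adjacency,
    hence it holds of any call, even one that stops for lack of depth. *)
Definition dfs_step (cand : pred V) (st st' : seq V * seq (otree V)) :=
  exists l, exists2 f, st' = (l ++ st.1, st.2 ++ f) &
    [/\ perm_eq l (postorders f), all cand l & uniq st.1 -> uniq (l ++ st.1)].

Lemma dfs_step_refl cand st : dfs_step cand st st.
Proof.
by exists [::]; exists [::]; rewrite /= ?cats0 //; case: st.
Qed.

Lemma dfs_step_trans cand st2 st1 st3 :
  dfs_step cand st1 st2 -> dfs_step cand st2 st3 -> dfs_step cand st1 st3.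
Proof.
move=> [l [f -> [lf cl ul]]] [l' [f' -> [lf' cl' ul']]].
exists (l' ++ l), (f ++ f'); first by rewrite /= !catA.
split; last by move=> /ul/ul'; rewrite /= catA.
  by rewrite map_cat flatten_cat perm_catC perm_cat.
by rewrite all_cat cl' cl.
Qed.

Lemma foldl_dfs_step cand (dfs : _ -> V -> _) st l :
    (forall st0 w, dfs_step cand st0 (dfs st0 w)) ->
  dfs_step cand st (foldl dfs st l).
Proof.
move=> dfsP; elim: l st => [|w l IHl] st /=; first exact: dfs_step_refl.
exact: dfs_step_trans (dfsP st w) (IHl _).
Qed.

Lemma partial_dfs_step adj cand k st v :
  dfs_step cand st (partial_dfs adj cand k st v).
Proof.
elim: k st v => [|k IHk] st v /=; first by rewrite if_same; apply: dfs_step_refl.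
case: ifP => [_|/norP[v_st /negPn cv]]; first exact: dfs_step_refl.
have [l [f -> [lf cl ul]]] :=
  foldl_dfs_step (v :: st.1, [::]) (adj v) (IHk).
exists (rcons l v); exists [:: Node v f]; first by rewrite /= cat_rcons cats1.
split=> [||u_st]; last by rewrite cat_rcons ul //= v_st.
  by rewrite /= cats0 -!cats1 perm_cat2r.
by rewrite all_rcons cl andbT.
Qed.

Lemma dfs_step_sub cand st st' : dfs_step cand st st' -> {subset st.1 <= st'.1}.
Proof. by move=> [l [f -> _]] v v_st; rewrite mem_cat v_st orbT. Qed.

Lemma mem_partial_dfs adj (cand : pred V) k st v :
  cand v -> v \in (partial_dfs adj cand k.+1 st v).1.
Proof.
move=> cv; rewrite /= cv orbF; case: ifP => //= _.
have /dfs_step_sub-> // :=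
  foldl_dfs_step (v :: st.1, [::]) (adj v) (partial_dfs_step adj cand k).
exact: mem_head.
Qed.

Lemma mem_foldl_dfs adj (cand : pred V) k st l w : w \in l -> cand w ->
  w \in (foldl (partial_dfs adj cand k.+1) st l).1.
Proof.
move=> + cw; elim: l st => //= u l IHl st; rewrite inE => /predU1P[<-|/IHl->//].
have /dfs_step_sub-> // := foldl_dfs_step (partial_dfs adj cand k.+1 st w) l
  (partial_dfs_step adj cand k.+1).
exact: mem_partial_dfs.
Qed.

(** The shape of the new tree depends on the scanning order, but its vertex set does not: each
    candidate is visited at the latest when the scan of [adj v] meets it. Depth two is enough for
    this. *)
Lemma partial_dfs_star adj (cand : pred V) k v : cand v ->
    (forall w, cand w -> w != v -> w \in adj v) ->
  exists l, exists2 f,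
    partial_dfs adj cand k.+2 ([::], [::]) v = (l, [:: Node v f]) &
    [/\ perm_eq l (postorder (Node v f)), uniq l & l =i cand].
Proof.
move=> cv adjv.
have [l [f Edfs [lf cl ul]]] := partial_dfs_step adj cand k.+2 ([::], [::]) v.
have := mem_partial_dfs adj k.+1 ([::], [::]) cv.
have: forall w, cand w -> w != v ->
    w \in (partial_dfs adj cand k.+2 ([::], [::]) v).1.
  by move=> w cw wv; rewrite /= cv /= mem_foldl_dfs // adjv.
rewrite Edfs /= cats0 => l_cand l_v.
move: (Edfs); rewrite /= cv /=; set st' := foldl _ _ _ => -[_ Ef].
exists l, st'.2; first by rewrite Ef.
rewrite cats0 in ul; split; last 2 first.
- exact: ul.
- move=> w; apply/idP/idP => [/(allP cl)|cw]; first by [].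
  by have [->|/l_cand->] := eqVneq w v.
by rewrite (permPl lf) -Ef /= cats0.
Qed.

(** * Pruning and grafting among leaves *)

(** The body of [prune] below the root, named so that forests can be cut and concatenated. *)
Definition prune_forest R f :=
  pmap (fun u => if troot u \in R then None else Some (prune R u)) f.

Lemma prune_forest_leaf R l : [predI R & l] =1 pred0 ->
  prune_forest R (map leaf l) = map leaf l.
Proof.
elim: l => //= v l IHl R'l; have := R'l v; rewrite /= mem_head andbT => ->.
rewrite -[X in _ :: X]IHl // => w; have := R'l w.
by rewrite /= inE; case: (w \in R) => //= /norP[_ /negPf].
Qed.

Lemma prune_forest_leaf_sub R l : {subset l <= R} ->
  prune_forest R (map leaf l) = [::].
Proof.
elim: l => //= v l IHl lR; rewrite lR ?mem_head //=.
by apply: IHl => w wl; rewrite lR // inE wl orbT.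
Qed.

Lemma prune_forest_cat R f1 f2 :
  prune_forest R (f1 ++ f2) = prune_forest R f1 ++ prune_forest R f2.
Proof. exact: pmap_cat. Qed.

Lemma graft_leaf x new l : x \notin l ->
  map (graft x new) (map leaf l) = map leaf l.
Proof.
by elim: l => //= v l IHl; rewrite inE eq_sym => /norP[/negPf-> /IHl->].
Qed.

(* The children us of the root to the right of the leaves not used yet: first come
   all leaves of A, later the vertex of B that carries the tree of a. *)
Definition search_state a A us B :=
  (exists2 P, perm_eq (rcons P a) A & postorders us = rcons P a ++ B) /\
  (forall R, R =i A -> prune_forest R us = map leaf B).

(** * The costly insertions *)

Hypothesis ordP : adjacency_order ord.

Lemma size_ord E v : size (ord E v) = count (fun e => e.1 == v) E.
Proof. by rewrite (perm_size (ordP E v)) size_map size_filter. Qed.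

(** Since [x] directly precedes the block of [A] in postorder and [a] ends that block, the
    candidates are exactly [A], and [a] reaches all of them. Afterwards [x] carries the tree of [a]
    and the next leaf to the left is in the same situation. *)
Lemma fdfs_insert_search s B1 x us a A B E :
    uniq (s :: B1 ++ x :: A ++ B) -> a \in A -> search_state a A us B ->
    (forall w, w \in A -> w != a -> (a, w) \in E) ->
  exists us' c,
  [/\ fdfs_insert ord E (Node s (map leaf B1 ++ leaf x :: us)) (x, a) =
        (Node s (map leaf B1 ++ us'), c),
      search_state a A us' (x :: B) &
      count (fun e => e.1 \in A) E <= c <= (size E).+1 + #|V|].
Proof.
set T := Node s _ => uT aA [[P PA usP] usR] Ea.
have T_post: postorder T = rcons B1 x ++ rcons P a ++ rcons B s.
  rewrite /= map_cat flatten_cat postorders_leaf /= usP.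
  by rewrite rcons_cat /= rcons_cat [RHS]cat_rcons.
have uT': uniq (postorder T).
  rewrite (@perm_uniq _ _ (s :: B1 ++ x :: A ++ B)) // T_post.
  apply/permP => p; have := permP PA p.
  by rewrite -!cats1 /= !count_cat /= ?count_cat /=; lia.
have DFNa: DFN T a = size B1 + (size P).+1.
  rewrite /DFN; have: postorder T = (rcons B1 x ++ P) ++ a :: rcons B s.
    by rewrite T_post [rcons P a ++ _]cat_rcons catA.
  move: uT' => /[swap] ->; move/index_pivot_uniq->.
  by rewrite size_cat size_rcons addSnnS.
have DFNx: DFN T x = size B1.
  rewrite /DFN; move: uT'; rewrite T_post cat_rcons.
  exact: index_pivot_uniq.
have candE : [pred z | DFN T x < DFN T z <= DFN T a] =i A.
  move: uT'; rewrite T_post => uT' z.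
  rewrite -(perm_mem PA) (mem_index_infix z uT') -T_post inE.
  by rewrite DFNa DFNx !size_rcons addSn ltnS addnS.
have uA : uniq A.
  by move: uT => /= /andP[_]; rewrite cat_uniq /= cat_uniq => /and5P[].
have sx : s != x.
  by move: uT => /= /andP[]; rewrite mem_cat inE !negb_or => /and3P[].
(* One counting inequality from which [lia] extracts all the disjointness facts below. *)
have cnt w :
    count_mem w B1 + ((x == w) + (count_mem w A + count_mem w B)) <= 1.
  move: uT => /= /andP[_ /(count_uniq_mem w)].
  by rewrite count_cat /= count_cat => ->; apply: leq_b1.
have memE w l : (w \in l) = (0 < count_mem w l) by rewrite -has_count has_pred1.
have A'B1 : [predI A & B1] =1 pred0.
  by move=> w; apply/negP => /andP[/=]; rewrite !memE; have := cnt w; lia.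
have A'B : [predI A & B] =1 pred0.
  by move=> w; apply/negP => /andP[/=]; rewrite !memE; have := cnt w; lia.
have xA : x \notin A by rewrite memE; have := cnt x; rewrite eqxx; lia.
have xB : x \notin B1 ++ B.
  by rewrite mem_cat !memE; have := cnt x; rewrite eqxx; lia.
pose E' := rcons E (x, a).
pose cand := [pred z | DFN T x < DFN T z <= DFN T a].
(* The distinct vertices [s] and [x] guarantee the depth two that the search needs. *)
have [k cardV] : exists k, #|V| = k.+2.
  have : #|[:: s; x]| <= #|V| by apply: max_card.
  rewrite (card_uniqP _) /= ?inE ?sx //.
  by case: #|V| => [|[|k]] // _; exists k.
have [||l [f dfsE [lf ul lA]]] := @partial_dfs_star (ord E') cand k a.
- by rewrite [cand a]candE.
- move=> w cw wa; rewrite (perm_mem (ordP _ _)); apply/mapP; exists (a, w) => //.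
  rewrite mem_filter /= eqxx mem_rcons inE Ea ?orbT //.
  by rewrite -candE.
have {candE}lA : l =i A by move=> w; rewrite lA candE.
(* Pruning [A] from [us] leaves only the leaves of [B]; the new tree hangs below the former leaf
   [x]. *)
exists (Node x [:: Node a f] :: map leaf B); eexists; split.
- rewrite /fdfs_insert leqNgt ifN; last by rewrite negbK DFNa DFNx; lia.
  rewrite -/E' -/cand cardV dfsE; congr (_, _).
  rewrite /= -/(prune_forest l _) (negPf sx) prune_forest_cat.
  rewrite prune_forest_leaf => [|w]; last by rewrite /= lA; apply: A'B1.
  rewrite /= lA (negPf xA) map_cat -/(prune_forest l us) usR //.
  move: xB; rewrite mem_cat => /norP[xB1 xB].
  by rewrite /= eqxx !graft_leaf.
- split.
    exists (postorders f); last by rewrite /= cats0 cat_rcons postorders_leaf.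
    by rewrite -(permPl lf) uniq_perm.
  move=> R RA; rewrite /prune_forest /= RA (negPf xA) RA aA.
  rewrite -/(prune_forest R _) prune_forest_leaf // => w.
  by rewrite /= RA; apply: A'B.
rewrite (eq_bigr _ (fun v _ => size_ord E' v)) sum_count_fst //.
rewrite (eq_count (a2 := fun e => e.1 \in A)); last by move=> e; rewrite lA.
have -> : (size E).+1 = size E' by rewrite size_rcons.
rewrite leq_add ?count_size ?max_card // andbT.
by rewrite (leq_trans _ (leq_addr _ _)) // /E' -cats1 count_cat leq_addr.
Qed.

(** Induction from the right end of [B1], each step moving one vertex to the front of [B]. The graph
    only grows, so each search processes at least the edges leaving [A] in [E], and at most
    [size E + size B1] edges. *)
Lemma fdfs_run_search s B1 us a A B E :
    uniq (s :: B1 ++ A ++ B) -> a \in A -> search_state a A us B ->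
    (forall w, w \in A -> w != a -> (a, w) \in E) ->
  exists us' c,
  [/\ fdfs_run ord E (Node s (map leaf B1 ++ us)) [seq (b, a) | b <- rev B1] =
        (Node s us', c),
      search_state a A us' (B1 ++ B) &
      size B1 * count (fun e => e.1 \in A) E <= c
        <= size B1 * (size E + size B1 + #|V|)].
Proof.
elim/last_ind: B1 us B E => [|B1 x IHB] us B E uB aA usP Ea.
  by exists us, 0; rewrite !mul0n.
rewrite map_rcons rev_rcons map_cons !cat_rcons size_rcons fdfs_run_cons.
have uT : uniq (s :: B1 ++ x :: A ++ B) by rewrite -cat_rcons.
have [us1 [c1 [-> us1P c1P]]] := fdfs_insert_search uT aA usP Ea.
have uIH : uniq (s :: B1 ++ A ++ x :: B).
  rewrite (@perm_uniq _ _ (s :: B1 ++ x :: A ++ B)) //.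
  by apply/permP => p; rewrite /= !count_cat /= ?count_cat /=; lia.
have EaIH w : w \in A -> w != a -> (a, w) \in rcons E (x, a).
  by move=> wA wa; rewrite mem_rcons inE Ea ?orbT.
have [us2 [c2 [-> us2P c2P]]] := IHB us1 (x :: B) (rcons E (x, a)) uIH aA us1P EaIH.
exists us2, (c1 + c2); split=> //.
move: c2P; rewrite size_rcons -cats1 count_cat mulnDr; nia.
Qed.

(** Phases one and three are free. Each of the [size B] searches in between processes all of [es1],
    because these edges leave vertices of [a :: A]. *)
Lemma fdfs_run_three_phases s B a A E es1 es3 :
    uniq (s :: B ++ rev (a :: A)) ->
    {subset es1 <= ordered_pairs (a :: A)} ->
    {subset [seq (a, w) | w <- A] <= es1} ->
    {subset es3 <= [seq (b, w) | b <- rev B, w <- A] ++ ordered_pairs (rev B)} ->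
  size B * size es1
    <= (fdfs_run ord E (Node s (map leaf (B ++ rev (a :: A))))
         (es1 ++ [seq (b, a) | b <- rev B] ++ es3)).2
    <= size B * (size E + size es1 + size B + #|V|).
Proof.
move=> uBA es1A es1a es3B.
have uB : uniq B by move: uBA; rewrite /= cat_uniq => /and4P[].
have uA : uniq (rev (a :: A)) by move: uBA; rewrite /= cat_uniq => /and4P[].
have sB : s \notin B by move: uBA; rewrite /= mem_cat negb_or -andbA => /and3P[].
have sA : s \notin rev (a :: A).
  by move: uBA; rewrite /= mem_cat negb_or -andbA => /and3P[].
have B'A v : v \in rev (a :: A) -> (v \in B) = false.
  by move: uBA; rewrite /= cat_uniq => /and4P[_ _ /hasPn + _] => /[apply] /negPf.
set T0 := Node s _; have run0 : fdfs_run ord E T0 es1 = (T0, 0).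
  apply: fdfs_run_no_anticross => e /es1A eA.
  have /ltnW : index e.2 (rev (a :: A)) < index e.1 (rev (a :: A)).
    by apply: index_ordered_pairs_rev; rewrite ?revK.
  have [] := mem_ordered_pairs eA; rewrite -!(mem_rev (a :: A)) => e1A e2A.
  rewrite /DFN /= postorders_leaf -cats1 -catA !index_cat.
  by rewrite !B'A // e1A e2A leq_add2l.
have uBA0 : uniq (s :: B ++ rev (a :: A) ++ [::]) by rewrite cats0.
have aA : a \in rev (a :: A) by rewrite mem_rev mem_head.
have T0P : search_state a (rev (a :: A)) (map leaf (rev (a :: A))) [::].
  split; first by exists (rev A); rewrite -?rev_cons // cats0 postorders_leaf.
  by move=> R RA; apply: prune_forest_leaf_sub => w; rewrite RA.
have Ea w : w \in rev (a :: A) -> w != a -> (a, w) \in E ++ es1.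
  rewrite mem_rev inE => /predU1P[->|wA wa]; first by rewrite eqxx.
  by rewrite mem_cat es1a ?orbT //; apply: map_f.
have [us [c [runE [[P PA usP] _] cP]]] := fdfs_run_search uBA0 aA T0P Ea.
rewrite fdfs_run_cat run0 fdfs_run_cat /T0 map_cat runE /=.
(* The postorder is now the block of [A], then [B], then [s], so the edges of [es3] go from right to
   left. *)
rewrite fdfs_run_no_anticross => [|e /es3B e_es3].
  rewrite add0n addn0; move: cP; rewrite size_cat count_cat.
  suff -> : count (fun e => e.1 \in rev (a :: A)) es1 = size es1.
    by rewrite mulnDr => /andP[/(leq_trans (leq_addl _ _))-> ->].
  apply/eqP; rewrite -all_count; apply/allP => e /es1A/mem_ordered_pairs[].
  by rewrite mem_rev.
rewrite /DFN /= usP cats0 -cats1 -catA !index_cat !(perm_mem PA).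
have e1B : e.1 \in B.
  move: e_es3; rewrite mem_cat => /orP[/allpairsP[p [pB _ ->]]|/mem_ordered_pairs[]].
    by rewrite -mem_rev.
  by rewrite mem_rev.
have -> : (e.1 \in rev (a :: A)) = false by apply: contraTF e1B => /B'A->.
rewrite e1B; case: ifP => e2A.
  by rewrite (leq_trans (index_size _ _)) // leq_addr.
move: e_es3; rewrite mem_cat => /orP[/allpairsP[p [_ pA De]]|eB].
  by move: e2A; rewrite De mem_rev inE pA orbT.
have [_] := mem_ordered_pairs eB; rewrite mem_rev => ->.
by rewrite leq_add2l ltnW // index_ordered_pairs_rev.
Qed.

End Run.

(** * The insertion sequence and its cost *)

Lemma map_ordered_pairs (T U : eqType) (h : T -> U) l :
  ordered_pairs (map h l) = [seq (h e.1, h e.2) | e <- ordered_pairs l].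
Proof. by elim: l => //= x l ->; rewrite map_cat -!map_comp. Qed.

(** The given [ord] fixes the left-to-right order of the initial leaves, so the insertion sequence
    must be built from the list [l] obtained here. *)
Lemma root_order (n : nat)
    (ord : seq (avertex n * avertex n) -> avertex n -> seq (avertex n)) :
    adjacency_order ord ->
  exists2 l, ord (root_edges n) None = map Some l & perm_eq l (enum 'I_n).
Proof.
move=> ordP; set s := ord _ _.
have sP : perm_eq s (map Some (enum 'I_n)).
  rewrite (permPl (ordP _ _)) /root_edges filter_map -map_comp.
  by rewrite (@eq_filter _ _ predT) ?filter_predT.
have Ds : map Some (pmap id s) = s.
  rewrite (pmap_filter (g := Some)); last by case.
  apply/all_filterP/allP => v; rewrite (perm_mem sP) => /mapP[i _ ->] //.
exists (pmap id s); rewrite ?Ds //.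
by apply: (perm_map_inj (@Some_inj _)); rewrite Ds.
Qed.

Lemma fdfs_time_bounds (n m : nat)
    (ord : seq (avertex n * avertex n) -> avertex n -> seq (avertex n)) :
    adjacency_order ord -> n <= m <= 'C(n, 2) ->
  exists es : seq ('I_n * 'I_n),
    [/\ size es = m, uniq es, forall k, acyclic (take k es) &
      m * n <= 24 * fdfs_time ord es /\ fdfs_time ord es <= 4 * (m * n)].
Proof.
move=> ordP /andP[nm mC].
have bin2E p : 2 * 'C(p, 2) = p * p.-1.
  by rewrite mulnC (bin_ffact p 2) ffactnS ffactn1.
have [n0|n_gt0] := posnP n.
  have m0 : m = 0 by move: mC; rewrite n0; case: (m).
  by exists [::]; rewrite m0; split=> // k; apply: (@acyclic_ordered_pairs_rev _ [::]).
(* For [n] equal to 1 or 2, no [m] satisfies both bounds. *)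
have n_gt2 : 2 < n.
  by case: n n_gt0 nm mC {ord ordP} => [|[|[|n]]] //; case: m => [|[|m]].
have [l ord_l l_enum] := root_order ordP.
pose k := n./2.
have nk : 2 * k <= n <= (2 * k).+1 by rewrite /k; lia.
have size_l : size l = n by rewrite (perm_size l_enum) size_enum_ord.
have ul : uniq l by rewrite (perm_uniq l_enum) enum_uniq.
pose B := take k l.
have size_B : size B = k by rewrite size_take size_l; case: ltnP => //; lia.
have [a [A Dl]] : exists a A, l = B ++ rev (a :: A).
  case Dr: (rev (drop k l)) => [|a A].
    by move: (congr1 size Dr); rewrite size_rev size_drop size_l /=; lia.
  by exists a, A; rewrite -Dr revK cat_take_drop.
have size_A : k + (size A).+1 = n.
  by move: size_l; rewrite Dl size_cat size_rev size_B.
(* As many edges inside [a :: A] as fit while keeping [k] insertions for the searches. *)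
pose e1 := minn 'C((size A).+1, 2) (m - k).
pose es3 := [seq (b, w) | b <- rev B, w <- A] ++ ordered_pairs (rev B).
pose all_es := ordered_pairs (a :: A) ++ [seq (b, a) | b <- rev B] ++ es3.
(* Along l' every edge goes from right to left: the vertices of rev (a :: A) end
   up before those of B in postorder. *)
pose l' := rev (a :: A) ++ B.
have ul' : uniq l' by rewrite uniq_catC -Dl.
have size_l' : size l' = n by rewrite size_cat addnC -size_cat -Dl.
have all_esP : perm_eq all_es (ordered_pairs (rev l')).
  rewrite rev_cat revK perm_sym (permPl (perm_ordered_pairs_cat _ _)).
  rewrite /all_es perm_cat2l /es3 catA perm_cat2r.
  by rewrite perm_allpairs_consr.
have size_es3 : 'C((size A).+1, 2) + (k + size es3) = 'C(n, 2).
  have := perm_size all_esP; rewrite size_ordered_pairs size_rev size_l' => <-.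
  rewrite (size_cat (ordered_pairs (a :: A)) (_ ++ _)).
  rewrite (size_cat [seq (b, a) | b <- rev B] es3).
  by rewrite size_ordered_pairs (size_map (fun b => (b, a))) size_rev size_B.
pose es1 := take e1 (ordered_pairs (a :: A)).
pose es := es1 ++ [seq (b, a) | b <- rev B] ++ take (m - k - e1) es3.
have size_es1 : size es1 = e1.
  rewrite size_take_min size_ordered_pairs /=; exact/minn_idPl/geq_minl.
have es_sub : subseq es all_es.
  by rewrite !cat_subseq ?take_subseq.
exists es; split.
- rewrite !size_cat size_es1 size_map size_rev size_B size_take_min.
  have e1E : e1 = minn _ _ := erefl; move: size_es3 size_A e1E.
  by move: (size es3) (size A) => c r; lia.
- apply: subseq_uniq es_sub _.
  by rewrite (perm_uniq all_esP) uniq_ordered_pairs ?rev_uniq.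
- move=> j; apply: acyclic_ordered_pairs_rev ul' _ => e /mem_take/(mem_subseq es_sub).
  by rewrite (perm_mem all_esP).
have es1_star : {subset [seq (a, w) | w <- A] <= es1}.
  (* Since [m] is at least [n], the prefix [es1] is long enough to contain every edge leaving
     [a]. *)
  have Ae1 : size A <= e1 by rewrite leq_min; have := bin2E (size A).+1; nia.
  by rewrite /es1 take_cat size_map ltnNge Ae1 => e eA; rewrite mem_cat eA.
have := @fdfs_run_three_phases _ ord ordP None (map Some B) (Some a) (map Some A)
  (root_edges n) (augment es1) (augment (take (m - k - e1) es3)).
have -> : map Some B ++ rev (Some a :: map Some A) = map Some l :> seq (avertex n).
  by rewrite Dl map_cat map_rev.
have size_E : size (root_edges n) = n by rewrite size_map size_enum_ord.
have -> : [seq Node v [::] | v <- map Some l] =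
    [seq Node v [::] | v <- ord (root_edges n) None] by rewrite ord_l.
rewrite size_E !size_map size_B size_es1 card_option card_ord.
rewrite -/(init_tree ord) => costP.
have {}costP : k * e1 <= fdfs_time ord es <= k * (n + e1 + k + n.+1).
  have -> : fdfs_time ord es = (fdfs ord es).2 by [].
  rewrite /fdfs; have -> : augment es = augment es1 ++
      [seq (b, Some a) | b <- map Some (rev B)] ++ augment (take (m - k - e1) es3).
    by rewrite /augment !map_cat -!map_comp.
  move: costP; rewrite -map_rev; apply.
  - rewrite /= map_inj_uniq ?ul ?andbT; last exact: Some_inj.
    by apply/mapP => -[].
  - move=> e /mapP[e' /mem_take e'A ->].
    by rewrite (map_ordered_pairs Some (a :: A)); apply: map_f.
  - move=> e /mapP[_ /mapP[w wA ->] ->].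
    by apply/mapP; exists (a, w); rewrite // es1_star ?map_f.
  move=> e /mapP[e' /mem_take]; rewrite /es3 !mem_cat map_ordered_pairs.
  case/orP => [/allpairsP[p [pB pA ->]]|e'B] ->; apply/orP; last by right; apply: map_f.
  by left; apply: allpairs_f; apply: map_f.
case/andP: costP => lb ub.
have e1m : e1 <= m - k by apply: geq_minr.
(* With [e1 + k <= m], the second factor is at most [m + 2 * n + 1], hence at most [4 * m]. *)
split; last by apply: leq_trans ub _; rewrite (mulnC m) mulnCA leq_mul; lia.
apply: leq_trans (leq_mul (leqnn 24) lb).
(* The constant 24 is 8 times 3, the latter from [n <= 2 * k + 1 <= 3 * k]. *)
suff m_le : m <= 8 * e1.
  have -> : 24 * (k * e1) = 8 * e1 * (3 * k) by lia.
  by rewrite leq_mul //; lia.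
(* If [e1] is [m - k], then [2 * k <= n <= m] suffices; otherwise [m] is compared with the number of
   all pairs. *)
rewrite /e1 /minn; case: ifP => _; last by lia.
have : n * n.-1 <= (2 * (size A).+1) * (4 * (size A)) by rewrite leq_mul //; lia.
by have := bin2E (size A).+1; have := bin2E n; lia.
Qed.

(** * Passage to rational constants *)

Import Order.TTheory GRing.Theory Num.Theory.
Local Open Scope ring_scope.

Theorem theoremC1 :
  exists c1 c2 : rat, 0 < c1 /\ 0 < c2 /\
    forall (n m : nat)
      (ord : seq (avertex n * avertex n) -> avertex n -> seq (avertex n)),
    adjacency_order ord ->
    (n <= m <= 'C(n, 2))%N ->
    exists es : seq ('I_n * 'I_n),
      [/\ size es = m, uniq es,
          forall k : nat, acyclic (take k es) &
          c1 * (m * n)%:R <= (fdfs_time ord es)%:R <= c2 * (m * n)%:R].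
Proof.
exists 24%:R^-1, 4%:R; split=> //; split=> // n m ord ordP nm.
have [es [size_es ues ac_es [lb ub]]] := fdfs_time_bounds ordP nm.
exists es; split=> //.
by rewrite ler_pdivrMl ?ltr0n // -!natrM !ler_nat lb.
Qed.
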